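(* Let $M$ and $N$ be indecomposable $A$-modules, and let $[a,b]$ and $[a',b']$ be the intervals associated with their representations, respectively. Then $\operatorname{Hom}_A(M,N)\cong 0$ if and only if one of the following conditions holds: (F1) $[a,b]$ and $[a',b']$ do not intersect (that is, it is not the case that both $a\le b'$ and $a'\le b$); (F2) $b<b'$ or $a<a'$.
   Context: $\mathbb{F}$ is an algebraically closed field, $n\ge 3$, $Q$ is the linearly oriented quiver $1\to 2\to\cdots\to n$ of type $\mathbb{A}_n$, and $A=\mathbb{F}Q/I$ where $I$ is an admissible ideal generated by a set of paths of length at least $2$ (a Nakayama algebra of type I). $A$-modules are finite-dimensional and are identified with finite-dimensional representations of $Q$ (vector spaces $V_i$ and linear maps $V_i\to V_{i+1}$) satisfying the relations in $I$. For $1\le i\le j\le n$, $[i,j]$ denotes the interval representation with $\mathbb{F}$ at every vertex $l$ with $i\le l\le j$ and $0$ elsewhere, with identity maps between consecutive copies of $\mathbb{F}$ and zero maps elsewhere. The indecomposable $A$-modules are, up to isomorphism, the interval representations that satisfy the relations in $I$. *)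

(* Defs.v *)
From HB Require Import structures.
From mathcomp Require Import all_boot all_order all_algebra.
Set Implicit Arguments.
Unset Strict Implicit.
Unset Printing Implicit Defensive.
Import GRing.Theory.
Local Open Scope ring_scope.

(* Vertices are numbered from 0: the vertex i : 'I_n is the vertex i + 1 of
   1 -> 2 -> ... -> n.  There is an arrow i -> j exactly when j = i.+1.

   Between two vertices there is at most one path, and there is one from i to j
   exactly when i <= j; a path is therefore encoded by its endpoints. *)
Definition qpath (n : nat) : finType :=
  {p : 'I_n * 'I_n | (p.1 <= p.2)%N}.

Section Paths.
Variable n : nat.
Implicit Types p q r : qpath n.

Definition psrc p : 'I_n := (val p).1.
Definition ptgt p : 'I_n := (val p).2.
Definition plen p : nat := (ptgt p - psrc p)%N.

(* r is the concatenation "p, then q". *)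
Definition is_concat p q r : bool :=
  [&& psrc r == psrc p, ptgt p == psrc q & ptgt r == ptgt q].
End Paths.

(* The path algebra FQ: formal F-linear combinations of paths. *)
Notation path_algebra F n := ({ffun qpath n -> F}) (only parsing).

Section PathAlgebra.
Variables (F : fieldType) (n : nat).
Implicit Types (x y : path_algebra F n) (I : path_algebra F n -> Prop).

Definition path_elt (p : qpath n) : path_algebra F n :=
  [ffun q => (q == p)%:R].

Definition path_mul x y : path_algebra F n :=
  [ffun r => \sum_(p : qpath n) \sum_(q : qpath n | is_concat p q r) x p * y q].

(* Closure under scalars follows, since FQ is a unital algebra. *)
Definition two_sided_ideal I : Prop :=
  [/\ I 0,
      forall x y, I x -> I y -> I (x + y)
    & forall x y, I y -> I (path_mul x y) /\ I (path_mul y x)].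

Definition ideal_gen (S : {set qpath n}) (x : path_algebra F n) : Prop :=
  forall I, two_sided_ideal I -> (forall p, p \in S -> I (path_elt p)) -> I x.

(* The m-th power of the arrow ideal: it is spanned by the paths of length at
   least m. *)
Definition arrow_ideal_pow (m : nat) x : Prop :=
  forall p, x p != 0 -> (m <= plen p)%N.

Definition admissible I : Prop :=
  [/\ two_sided_ideal I,
      forall x, I x -> arrow_ideal_pow 2 x
    & exists2 m, (2 <= m)%N & forall x, arrow_ideal_pow m x -> I x].
End PathAlgebra.

Record rep (F : fieldType) (n : nat) := Rep {
  rep_space :> 'I_n -> vectType F;
  rep_map : forall i j : 'I_n, j = i.+1 :> nat -> 'Hom(rep_space i, rep_space j)
}.

Section Representations.
Variables (F : fieldType) (n : nat).
Implicit Types (M N : rep F n) (I : path_algebra F n -> Prop).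

(* map_along M i j f: f is the composite of the arrow maps of M along the path
   from i to j.  For i <= j there is exactly one such f. *)
Inductive map_along M (i : 'I_n) : forall j : 'I_n, 'Hom(M i, M j) -> Prop :=
| map_along_nil : map_along \1%VF
| map_along_cons (j k : 'I_n) (e : k = j.+1 :> nat) (f : 'Hom(M i, M j)) :
    map_along f -> map_along (rep_map M e \o f)%VF.

(* Parallel paths being equal, the component of the relation x between two
   vertices consists of the single term x p *: p. *)
Definition satisfies M (x : path_algebra F n) : Prop :=
  forall (p : qpath n) (f : 'Hom(M (psrc p), M (ptgt p))),
    map_along f -> x p *: f = 0.

(* Modules over FQ/I, as representations of Q. *)
Definition is_module I M : Prop := forall x, I x -> satisfies M x.

Record rep_hom M N := RepHom {
  hom_map :> forall i : 'I_n, 'Hom(M i, N i);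
  hom_mapP : forall (i j : 'I_n) (e : j = i.+1 :> nat),
    (rep_map N e \o hom_map i)%VF = (hom_map j \o rep_map M e)%VF
}.

Definition hom_trivial M N : Prop :=
  forall (f : rep_hom M N) (i : 'I_n), f i = 0.

Definition rep_iso M N : Prop :=
  exists (f : rep_hom M N) (g : rep_hom N M),
    forall i : 'I_n, (g i \o f i = \1)%VF /\ (f i \o g i = \1)%VF.

Definition rep_zero M : Prop := forall (i : 'I_n) (v : M i), v = 0.

Definition rep_sum M N : rep F n :=
  @Rep F n (fun i => (M i * N i)%type : vectType F)
    (fun i j e => linfun (fun v : M i * N i =>
                            (rep_map M e v.1, rep_map N e v.2))).

Definition indecomposable I M : Prop :=
  ~ rep_zero M /\
  forall M1 M2, is_module I M1 -> is_module I M2 ->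
    rep_iso M (rep_sum M1 M2) -> rep_zero M1 \/ rep_zero M2.

Definition in_interval (a b l : 'I_n) : bool := (a <= l <= b)%N.

(* The space at l is F ('rV_1) inside [a, b] and 0 ('rV_0) outside; the matrix
   pid_mx 1 is 1%:M when both dimensions are 1 and is empty otherwise. *)
Definition interval_rep (a b : 'I_n) : rep F n :=
  @Rep F n (fun l => 'rV[F]_(in_interval a b l))
    (fun i j _ => linfun (mulmxr (pid_mx 1 :
       'M[F]_(in_interval a b i, in_interval a b j)))).
End Representations.

(* Main.v *)
Require Import Defs.
From mathcomp Require Import all_boot all_order all_algebra.
From mathcomp Require Import zify.
Import GRing.Theory.

(** Homomorphisms between two interval representations are understood vertex by
    vertex: at each vertex both spaces have dimension at most 1, so a
    homomorphism can be nonzero only on the intersection of the two intervals,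
    and there it is a scalar, the same one all along the intersection because
    the arrows act as identities.  What remains is whether this common scalar is
    forced to vanish at one of the two ends.

    - If [a < a'], the arrow of [[a, b]] that enters the intersection is onto,
      while the target is zero just before it; zero is pushed forward along the
      arrows ([hom_eq0_forward]).
    - If [b < b'], the arrow of [[a', b']] that leaves the intersection is
      injective, while the source is zero just after it; zero is pulled back
      along the arrows ([hom_eq0_backward]).
    - Otherwise [a' <= a] and [b' <= b], and if the intervals meet the
      intersection is [[a, b']], which is a quotient of [[a, b]] and a
      submodule of [[a', b']]; the composite of the projection and the inclusion
      is a nonzero homomorphism ([interval_hom_map_commutes]).

    Vanishing of all homomorphisms depends only on the isomorphism classes of
    the two representations ([hom_trivial_iso]), which carries the result over
    to [M] and [N]. *)

Section Representations.
Local Open Scope ring_scope.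
Context {F : fieldType} {n : nat}.
Implicit Types M N : rep F n.

(** * Homomorphisms of representations *)

Lemma hom_map_natural {M N} (f : rep_hom M N) {i j : 'I_n}
    (e : j = i.+1 :> nat) (v : M i) :
  rep_map N e (f i v) = f j (rep_map M e v).
Proof. by have /lfunP/(_ v) := hom_mapP f e; rewrite !comp_lfunE. Qed.

Lemma hom_eq0_forward {M N} (f : rep_hom M N) {i j : 'I_n}
    (e : j = i.+1 :> nat) :
  (forall w, exists v, rep_map M e v = w) -> f i = 0 -> f j = 0.
Proof.
move=> surj fi0; apply/lfunP => w; have [v <-] := surj w.
by rewrite -hom_map_natural fi0 !lfunE linear0.
Qed.

Lemma hom_eq0_backward {M N} (f : rep_hom M N) {i j : 'I_n}
    (e : j = i.+1 :> nat) :
  injective (rep_map N e) -> f j = 0 -> f i = 0.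
Proof.
move=> inj fj0; apply/lfunP => v; apply: inj.
by rewrite hom_map_natural fj0 !lfunE linear0.
Qed.

Lemma rep_hom_comp_commutes {L M N} (g : rep_hom M N) (f : rep_hom L M)
    (i j : 'I_n) (e : j = i.+1 :> nat) :
  (rep_map N e \o (g i \o f i) = (g j \o f j) \o rep_map L e)%VF.
Proof. by apply/lfunP => v; rewrite !comp_lfunE !hom_map_natural. Qed.

Definition rep_hom_comp {L M N} (g : rep_hom M N) (f : rep_hom L M) :
  rep_hom L N :=
  @RepHom F n L N (fun i => g i \o f i)%VF (rep_hom_comp_commutes g f).

Lemma rep_iso_sym {M N} : rep_iso M N -> rep_iso N M.
Proof.
by move=> [f [g fgK]]; exists g, f => i; have [gf fg] := fgK i.
Qed.

(** Transporting [h : M -> N] to the isomorphic representations and back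
    recovers [h], so it is zero as soon as its transport is. *)
Lemma hom_trivial_iso {M M' N N'} :
  rep_iso M M' -> rep_iso N N' -> hom_trivial M' N' -> hom_trivial M N.
Proof.
move=> [f [g fgK]] [f' [g' fgK']] triv h i; apply/lfunP => v.
have [/lfunP/(_ v) gfv _] := fgK i.
have [/lfunP/(_ (h i v)) gfhv _] := fgK' i.
have /lfunP/(_ (f i v)) := triv (rep_hom_comp f' (rep_hom_comp h g)) i.
move: gfv gfhv; rewrite /= !comp_lfunE !id_lfunE !zero_lfunE => -> gfhv fhv0.
by rewrite -gfhv fhv0 linear0.
Qed.

(** * Partial identity matrices of dimension at most 1 *)

Lemma pid1_mx_id (x : bool) : pid_mx 1 = 1%:M :> 'M[F]_x.
Proof. by case: x; [apply: pid_mx_1 | rewrite [LHS]flatmx0 [RHS]flatmx0]. Qed.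

(** A composite of canonical maps between spaces of dimension at most 1 is again
    canonical, unless it goes through 0. *)
Lemma pid1_mx_mul (x y z : bool) :
  (pid_mx 1 : 'M[F]_(x, y)) *m (pid_mx 1 : 'M[F]_(y, z)) =
  if y then pid_mx 1 else 0.
Proof. by rewrite mul_pid_mx; case: y => //; rewrite pid_mx_0. Qed.

Lemma mx_false_rows_eq (x : bool) m (A B : 'M[F]_(x, m)) : ~~ x -> A = B.
Proof. by case: x A B => // A B _; rewrite [A]flatmx0 [B]flatmx0. Qed.

Lemma mx_false_cols_eq (x : bool) m (A B : 'M[F]_(m, x)) : ~~ x -> A = B.
Proof. by case: x A B => // A B _; rewrite [A]thinmx0 [B]thinmx0. Qed.

(** * Interval representations *)

Lemma interval_mapE (a b i j : 'I_n) (e : j = i.+1 :> nat)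
    (v : interval_rep F a b i) :
  rep_map (interval_rep F a b) e v =
  (v : 'rV[F]_(in_interval a b i)) *m pid_mx 1 :> 'rV[F]_(in_interval a b j).
Proof. by rewrite lfunE. Qed.

Lemma interval_map_inj (a b i j : 'I_n) (e : j = i.+1 :> nat) :
  in_interval a b j -> injective (rep_map (interval_rep F a b) e).
Proof.
move=> jab; apply: (can_inj (g := fun w : 'rV_(in_interval a b j) =>
  w *m (pid_mx 1 : 'M[F]_(in_interval a b j, in_interval a b i)))) => v.
by rewrite interval_mapE -mulmxA pid1_mx_mul jab pid1_mx_id mulmx1.
Qed.

Lemma interval_map_surj (a b i j : 'I_n) (e : j = i.+1 :> nat) :
  in_interval a b i ->
  forall w, exists v, rep_map (interval_rep F a b) e v = w.
Proof.
move=> iab w; exists ((w : 'rV_(in_interval a b j)) *m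
  (pid_mx 1 : 'M[F]_(in_interval a b j, in_interval a b i))).
by rewrite interval_mapE -mulmxA pid1_mx_mul iab pid1_mx_id mulmx1.
Qed.

Section TwoIntervals.
Variables a b a' b' : 'I_n.
Local Notation M := (interval_rep F a b).
Local Notation N := (interval_rep F a' b').

Lemma interval_hom_eq0_outside (f : rep_hom M N) (i : 'I_n) :
  ~~ (in_interval a b i && in_interval a' b' i) -> f i = 0.
Proof.
rewrite negb_and => /orP[iM|iN]; apply/lfunP => v; rewrite lfunE.
  by rewrite (mx_false_cols_eq _ _ v 0 iM) linear0.
exact: (mx_false_cols_eq _ _ (f i v) 0 iN).
Qed.

Lemma interval_hom_trivial_source_first :
  (a < a')%N -> hom_trivial M N.
Proof.
move=> lt_aa' f i; case: i => m; elim: m => [|m IHm] lt_mn.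
  by apply: interval_hom_eq0_outside; rewrite /in_interval /=; lia.
have [/andP[iM iN]|] :=
  boolP (in_interval a b (Ordinal lt_mn) && in_interval a' b' (Ordinal lt_mn));
  last exact: interval_hom_eq0_outside.
apply: (hom_eq0_forward f (i := Ordinal (ltnW lt_mn)) (j := Ordinal lt_mn)
  erefl _ (IHm _)).
by apply: interval_map_surj; move: iM iN; rewrite /in_interval /=; lia.
Qed.

Lemma interval_hom_trivial_target_last :
  (b < b')%N -> hom_trivial M N.
Proof.
move=> lt_bb' f i.
(* Induction on the distance from i to the last vertex. *)
have [k] := ubnP (n - i); elim: k i => // k IHk i le_k.
have [/andP[iM iN]|] := boolP (in_interval a b i && in_interval a' b' i);
  last exact: interval_hom_eq0_outside.
have lt_in : (i.+1 < n)%N.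
  by move: iM (ltn_ord b'); rewrite /in_interval; lia.
apply: (hom_eq0_backward f (j := Ordinal lt_in) erefl).
  by apply: interval_map_inj; move: iM iN; rewrite /in_interval /=; lia.
by apply: IHk => /=; lia.
Qed.

Definition interval_hom_map (i : 'I_n) : 'Hom(M i, N i) :=
  linfun (mulmxr (pid_mx 1 :
    'M[F]_(in_interval a b i, in_interval a' b' i))).

(** Both ways round a square the composite is canonical and can differ only if
    the path through one corner is cut: [a' <= a] keeps the corner [N i] alive,
    and [b' <= b] the corner [M j]. *)
Lemma interval_hom_map_commutes :
  (a' <= a)%N -> (b' <= b)%N ->
  forall (i j : 'I_n) (e : j = i.+1 :> nat),
  (rep_map N e \o interval_hom_map i = interval_hom_map j \o rep_map M e)%VF.
Proof.
move=> le_a'a le_b'b i j e; apply/lfunP => v.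
rewrite !comp_lfunE !interval_mapE !lfunE /= -!mulmxA.
congr (_ *m _); rewrite !pid1_mx_mul.
have [iM|iM] := boolP (in_interval a b i); last exact: mx_false_rows_eq.
have [jN|jN] := boolP (in_interval a' b' j); last exact: mx_false_cols_eq.
have -> : in_interval a' b' i.
  by move: iM jN; rewrite /in_interval; lia.
have -> // : in_interval a b j.
by move: iM jN; rewrite /in_interval; lia.
Qed.

Lemma interval_hom_nontrivial :
  (a' <= a)%N -> (a <= b')%N -> (b' <= b)%N -> ~ hom_trivial M N.
Proof.
move=> le_a'a le_ab' le_b'b triv.
have := triv (@RepHom F n M N _ (interval_hom_map_commutes le_a'a le_b'b)) a.
have aM : in_interval a b a by rewrite /in_interval; lia.
have aN : in_interval a' b' a by rewrite /in_interval; lia.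
move=> /lfunP/(_ (pid_mx 1 : 'rV[F]_(in_interval a b a))).
rewrite !lfunE /= (pid1_mx_mul true) aM => /eqP.
by rewrite -mxrank_eq0 rank_pid_mx ?aN.
Qed.

Lemma interval_hom_trivialP :
  (a <= b)%N -> (a' <= b')%N ->
  hom_trivial M N <->
    ~ ((a <= b')%N /\ (a' <= b)%N) \/ ((b < b')%N \/ (a < a')%N).
Proof.
move=> le_ab le_a'b'; split=> [triv|[disj|[lt_bb'|lt_aa']]].
- have [?|le_b'b] := ltnP b b'; first by right; left.
  have [?|le_a'a] := ltnP a a'; first by right; right.
  left=> -[le_ab' _].
  exact: (interval_hom_nontrivial le_a'a le_ab' le_b'b).
- move=> f i; apply: interval_hom_eq0_outside.
  by apply/negP; rewrite /in_interval => iMN; apply: disj; lia.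
- exact: interval_hom_trivial_target_last.
- exact: interval_hom_trivial_source_first.
Qed.

End TwoIntervals.
End Representations.

Theorem proposition3p3 (F : closedFieldType) (n : nat) (hn : (3 <= n)%N)
    (P : {set qpath n}) (hP : forall p : qpath n, p \in P -> (2 <= plen p)%N)
    (hI : admissible (ideal_gen (F := F) P))
    (M N : rep F n)
    (hM : is_module (ideal_gen (F := F) P) M)
    (hN : is_module (ideal_gen (F := F) P) N)
    (iM : indecomposable (ideal_gen (F := F) P) M)
    (iN : indecomposable (ideal_gen (F := F) P) N)
    (a b a' b' : 'I_n) (hab : (a <= b)%N) (hab' : (a' <= b')%N)
    (Mab : rep_iso M (interval_rep F a b))
    (Nab : rep_iso N (interval_rep F a' b')) :
  hom_trivial M N <->
    ~ ((a <= b')%N /\ (a' <= b)%N) \/ ((b < b')%N \/ (a < a')%N).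
Proof.
rewrite -interval_hom_trivialP //.
split; apply: hom_trivial_iso => //; exact: rep_iso_sym.
Qed.
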